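(* For every positive integer $n$, the critical exponent $m(n)$ satisfies $$m(n)\le \begin{cases}\dfrac{n^2-4n+5}{2} & \text{if } n \text{ is odd},\\[2mm] \dfrac{n^2-5n+8}{2} & \text{if } n \text{ is even}.\end{cases}$$
   Context: A real $n$-by-$n$ matrix is doubly nonnegative if it is symmetric, positive semidefinite, and entry-wise nonnegative. For positive semidefinite $A=\sum_i\lambda_ix_ix_i^T$ (orthonormal eigenvectors) and $t>0$, $A^t=\sum_i\lambda_i^tx_ix_i^T$. The (conventional) critical exponent $m(n)$ is the least value $m$ such that $A^t$ is doubly nonnegative for all $t\ge m$ and all $n$-by-$n$ doubly nonnegative matrices $A$. *)

(* Defs.v *)
From HB Require Import structures.
From mathcomp Require Import all_boot all_order all_algebra.
From mathcomp Require Import reals exp.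
Set Implicit Arguments. Unset Strict Implicit. Unset Printing Implicit Defensive.
Import Order.TTheory GRing.Theory Num.Theory.
Local Open Scope ring_scope.

Section DNN.
Variable R : realType.

Definition symmetricmx n (A : 'M[R]_n) : Prop := A^T = A.

Definition psdmx n (A : 'M[R]_n) : Prop :=
  symmetricmx A /\ forall x : 'cV[R]_n, 0 <= (x^T *m A *m x) 0 0.

Definition nonnegmx n (A : 'M[R]_n) : Prop := forall i j, 0 <= A i j.

Definition DNN n (A : 'M[R]_n) : Prop :=
  symmetricmx A /\ psdmx A /\ nonnegmx A.

Definition spectral_decomp n (A U : 'M[R]_n) (lambda : 'rV[R]_n) : Prop :=
  U^T *m U = 1%:M /\ A = U *m diag_mx lambda *m U^T.

(* A^t = sum_i lambda_i^t x_i x_i^T, computed from a spectral decomposition *)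
Definition mxpow_of n (U : 'M[R]_n) (lambda : 'rV[R]_n) (t : R) : 'M[R]_n :=
  U *m diag_mx (map_mx (fun l => powR l t) lambda) *m U^T.

Definition admissible_exponent (n : nat) (m : R) : Prop :=
  forall (t : R), 0 < t -> m <= t ->
  forall (A : 'M[R]_n), DNN A ->
  forall (U : 'M[R]_n) (lambda : 'rV[R]_n), spectral_decomp A U lambda ->
  DNN (mxpow_of U lambda t).

End DNN.

Definition m_bound (R : realType) (n : nat) : R :=
  if odd n then ((n ^ 2)%:R - 4 * n%:R + 5) / 2
  else ((n ^ 2)%:R - 5 * n%:R + 8) / 2.

(* Main.v *)
Require Import Defs.
From mathcomp Require Import all_boot all_order all_algebra.
From mathcomp Require Import reals exp.
From mathcomp Require Import boolp classical_sets functions topology.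
From mathcomp Require Import normedtype sequences derive realfun.
From mathcomp Require Import ring lra zify.
Set Implicit Arguments. Unset Strict Implicit. Unset Printing Implicit Defensive.
Import Order.TTheory GRing.Theory Num.Theory.
Import numFieldNormedType.Exports.
Local Open Scope ring_scope.

(** The entries [f(t)] of column [j] of [A^t] are exponential sums whose
exponents are the logarithms of the eigenvalues, nonnegative at every natural
number and, off the diagonal, zero at [0]. If such an entry has [b] dips, i.e.
becomes negative on [b] of the intervals [(k, k+1)] with [k >= 1], then its
values show [2b + 2] weakly alternating signs, so by Descartes' rule of signs
its [n] coefficients alternate at least as often and [2b + 2 <= n]. For even [n]
equality can hold for at most one row, since two such rows of the orthogonal
matrix of eigenvectors would have a positive inner product. Summing over the
off-diagonal rows, the [k]-th interval is free of dips in the whole column for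
some [k] not exceeding the bound; multiplying by the nonnegative matrix [A] then
propagates nonnegativity of the column to all [t >= k]. Singular matrices are
limits of [A + e I]. *)

(** * Sign alternations in finite sequences *)

Section SignAlternation.
Variable R : realDomainType.
Implicit Types (s x : R) (xs : seq R).

(* Length of the longest subsequence of [xs] with strictly alternating signs
   starting with the sign of [s]; taking the first admissible term is optimal. *)
Fixpoint alternations s xs : nat :=
  if xs is x :: xs' then
    if 0 < s * x then (alternations (- s) xs').+1 else alternations s xs'
  else 0%N.

Lemma alternations_le_size s xs : (alternations s xs <= size xs)%N.
Proof.
by elim: xs s => //= x xs IH s; case: ifP => _; rewrite ?ltnS ?IH// leqW.
Qed.

Lemma alternations_leN s xs :
  (alternations s xs <= (alternations (- s) xs).+1)%N.
Proof.
elim: xs s => //= x xs IH s; rewrite mulNr oppr_gt0 opprK.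
by case: ltgtP => // _; exact/leqW/leqnSn.
Qed.

Lemma alternations_cat_le0 s xs ys : all (fun x => s * x <= 0) xs ->
  alternations s (xs ++ ys) = alternations s ys.
Proof. by elim: xs => //= x xs IH /andP[/le_gtF-> /IH]. Qed.

(** A factor [w k <= 0] reverses the sign of a term or annihilates it, so an alternating subsequence
    of the products comes from one of [c] with the opposite starting sign. *)
Lemma alternations_rescale_le0 (T : Type) (c w : T -> R) s (r : seq T) :
  all (fun k => w k <= 0) r ->
  (alternations s [seq (c k * w k)%R | k <- r]
    <= alternations (- s)%R [seq c k | k <- r])%N.
Proof.
elim: r s => //= k r IH s /andP[wk wr]; have := IH s wr; have := IH (- s) wr.
rewrite opprK mulNr oppr_gt0 mulrA.
have [sc|sc|sc] := ltgtP (s * c k) 0; case: ifP => // h h1 h2.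
- apply: leq_trans h2 _.
  by have := alternations_leN (- s); rewrite opprK; exact.
- by exfalso; nra.
- by exfalso; move: h; rewrite sc mul0r ltxx.
Qed.

(** Full length forces every term to be taken, so the position alone prescribes the sign in both
    sequences. *)
Lemma alternations_full (T : eqType) (c d : T -> R) s (r : seq T) :
  alternations s [seq c k | k <- r] = size r ->
  alternations s [seq d k | k <- r] = size r ->
  {in r, forall k, 0 < c k * d k}.
Proof.
elim: r s => //= k r IH s.
case: ifPn => [sc|_ h]; last first.
  by have := alternations_le_size s [seq c i | i <- r]; rewrite h size_map ltnn.
case: ifPn => [sd|_ _ h]; last first.
  by have := alternations_le_size s [seq d i | i <- r]; rewrite h size_map ltnn.
move=> [hc] [hd] l; rewrite inE => /predU1P[->|]; last exact: IH hc hd l.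
have : 0 < (s * c k) * (s * d k) by rewrite mulr_gt0.
rewrite mulrACA pmulr_rgt0// -expr2 lt0r sqr_ge0 andbT sqrf_eq0.
by apply: contraTneq sc => ->; rewrite mul0r ltxx.
Qed.

(** Zero values fit either sign. *)
Fixpoint weakly_alternating s (f : R -> R) (ts : seq R) : bool :=
  if ts is t :: ts' then (0 <= s * f t) && weakly_alternating (- s) f ts'
  else true.

Lemma weakly_alternating_rescale s (f g w : R -> R) ts :
  (forall t, 0 < w t) -> (forall t, g t = w t * f t) ->
  weakly_alternating s g ts = weakly_alternating s f ts.
Proof.
move=> w0 gE; elim: ts s => //= t ts IH s.
by rewrite IH gE mulrCA pmulr_rge0.
Qed.

End SignAlternation.

(** * Exponential sums and Descartes' rule of signs *)

Section ExponentialSums.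
Variable R : realType.
Implicit Types (p : R * R) (r : seq (R * R)).

Definition expsum r (t : R) : R := \sum_(p <- r) p.1 * expR (p.2 * t).

Definition expsum_shift (a : R) r := [seq (p.1, p.2 - a) | p <- r].

Definition expsum_deriv r := [seq (p.1 * p.2, p.2) | p <- r].

Lemma expsum_shiftE a r t :
  expsum (expsum_shift a r) t = expR (- (a * t)) * expsum r t.
Proof.
rewrite /expsum big_map big_distrr/=; apply: eq_bigr => p _ /=.
by rewrite mulrBl expRD; ring.
Qed.

Lemma is_derive_expsum r t :
  is_derive t (1 : R) (expsum r) (expsum (expsum_deriv r) t).
Proof.
elim: r => [|[c a] r IH].
  rewrite (_ : expsum [::] = cst 0); last first.
    by apply/funext => x; rewrite /expsum big_nil.
  exact: is_derive_cst.
rewrite (_ : expsum _ = (fun x => c * expR (a * x)) + expsum r); last first.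
  by apply/funext => x; rewrite /expsum big_cons.
rewrite /expsum_deriv /expsum big_cons/=.
apply: is_deriveD.
have dax : is_derive t (1 : R) (fun x : R => a * x) a.
  by rewrite -[X in is_derive _ _ _ X]mulr1; exact: is_deriveZ.
have := @is_derive1_comp R expR _ t _ _ (is_derive_expR _) dax.
move=> /is_deriveZ-/(_ c) dc.
apply: (@is_derive_eq _ _ _ _ _ _ _ _ dc).
by rewrite /GRing.scale/= mulrA mulrAC.
Qed.

(** The points decrease, so [f t - f t'] has the weak sign of [f t], and so has the derivative at an
    intermediate point. *)
Lemma mvt_alternating s (f df : R -> R) t ts :
  (forall x, is_derive x (1 : R) f (df x)) ->
  path >%R t ts -> weakly_alternating s f (t :: ts) ->
  exists us, [/\ path >%R t us, size us = size ts
    & weakly_alternating s df us].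
Proof.
move=> dfE; elim: ts s t => [|t' ts IH] s t; first by exists [::].
move=> /= /andP[t't tsP] /andP[st tsA].
have [us [usP ussz usA]] := IH (- s) t' tsP tsA.
have /andP[st' _] := tsA.
have [u] : exists2 u, u \in `]t', t[%R & f t - f t' = df u * (t - t').
  apply: MVT => // x; apply: derivable_within_continuous => y _.
  exact: ex_derive.
rewrite in_itv/= => /andP[t'u ut] fu.
exists (u :: us); split => /=; rewrite ?ussz ?usA ?andbT ?ut//=.
  by case: us usP {ussz usA} => //= v us /andP[/lt_trans->].
rewrite -(@pmulr_lge0 _ (t - t')) ?subr_gt0// -mulrA -fu; nra.
Qed.

Lemma expsum_deriv_eq0 r t : (forall x, expsum (expsum_deriv r) x = 0) ->
  expsum r t = expsum r 0.
Proof.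
move=> d0; apply: (@is_derive_0_is_cst R (expsum r)) => x.
by rewrite -(d0 x); apply: is_derive_expsum.
Qed.

(** Otherwise all terms of [s * expsum r t] are nonpositive but their sum is not negative, so every
    coefficient vanishes. *)
Lemma expsum_neq0_has s r t : s != 0 -> (exists x, expsum r x != 0) ->
  0 <= s * expsum r t -> has (fun p => 0 < s * p.1) r.
Proof.
move=> s0 [x] fx st; apply: contra_neqT fx; rewrite -all_predC => /allP r0.
have term_le0 p : p \in r -> s * (p.1 * expR (p.2 * t)) <= 0.
  move=> /r0/=; rewrite -leNgt => sp.
  by rewrite mulrA pmulr_lle0// expR_gt0.
suff p0 : {in r, forall p, p.1 = 0}.
  by rewrite /expsum big_seq big1// => p pr; rewrite p0// mul0r.
have : \sum_(p <- r) - (s * (p.1 * expR (p.2 * t))) = 0.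
  apply/eqP; rewrite eq_le big_seq sumr_ge0 ?andbT => [|p pr]; last first.
    by rewrite oppr_ge0 term_le0.
  by rewrite -big_seq sumrN oppr_le0 -mulr_sumr.
move=> /eqP; rewrite big_seq psumr_eq0 => [/allP h p pr|p pr]; last first.
  by rewrite oppr_ge0 term_le0.
have := h p pr; rewrite pr/= oppr_eq0 !mulf_eq0 (negbTE s0)/= => /orP[/eqP//|].
by rewrite expR_eq0.
Qed.

(* Descartes' rule of signs, counting weak sign changes of the values. Dividing
   by the exponential of the first coefficient with the sign of [s] and
   differentiating removes one alternation from the coefficients, and by the
   mean value theorem at most one from the values. *)
Lemma expsum_alternations s r ts : s != 0 ->
  sorted (fun p q => q.2 <= p.2) r -> (exists x, expsum r x != 0) ->
  sorted >%R ts -> weakly_alternating s (expsum r) ts ->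
  (size ts <= alternations s [seq p.1 | p <- r])%N.
Proof.
move=> s0; move: {2}(size ts) (leqnn (size ts)) => m.
elim: m r ts => [|m IH] r [|t ts] //; rewrite ltnS => sz rP f0 tsP tsA.
have hs : has (fun p => 0 < s * p.1) r.
  by case/andP: tsA => h _; apply: expsum_neq0_has h.
case/split_find: hs rP f0 tsA => p r1 r2 sp; rewrite -all_predC.
move=> {r} r1s rP f0 tsA.
set r := rcons r1 p ++ r2 in rP f0 tsA *.
pose g := expsum_shift p.2 r; pose d := expsum_deriv g.
have rtr : transitive (fun p q : R * R => q.2 <= p.2).
  by move=> y x z h1 h2; exact: le_trans h2 h1.
have [r1p r2p] : all (fun q => p.2 <= q.2) r1 /\ all (fun q => q.2 <= p.2) r2.
  move: rP; rewrite /r cat_rcons sorted_pairwise// pairwise_cat/=.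
  case/and3P => h _ /andP[h2 _]; split => //.
  apply/allP => q qr; move/allrelP: h => /(_ q p qr).
  by rewrite inE eqxx; exact.
have altd : (alternations s [seq q.1 | q <- d] <
             alternations s [seq q.1 | q <- r])%N.
  have -> : [seq q.1 | q <- d] = [seq q.1 * (q.2 - p.2) | q <- r].
    by rewrite /d /g /expsum_deriv /expsum_shift -!map_comp.
  (* The factor [q.2 - p.2] is nonnegative before [p], zero at [p] and nonpositive after it: the
     alternation at [p] is lost and the tail is reversed. *)
  rewrite /r cat_rcons !map_cat/= !alternations_cat_le0.
  - rewrite /= sp subrr !mulr0 ltxx ltnS; apply: alternations_rescale_le0.
    by apply: sub_all r2p => q; rewrite subr_le0.
  - rewrite all_map; apply: sub_all r1s => q /=; by rewrite -leNgt.
  - rewrite all_map; apply/allP => q qr /=; rewrite mulrA.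
    move/allP: r1s => /(_ q qr)/=; rewrite -leNgt => h.
    by rewrite mulr_le0_ge0// subr_ge0; move/allP: r1p; exact.
apply: leq_trans altd; rewrite /= ltnS.
have gA : weakly_alternating s (expsum g) (t :: ts).
  rewrite (@weakly_alternating_rescale _ s (expsum r) _
    (fun t => expR (- (p.2 * t))))//.
  - by move=> x; exact: expR_gt0.
  - by move=> x; exact: expsum_shiftE.
have [us [usP ussz usA]] := mvt_alternating (is_derive_expsum g) tsP gA.
have [->//|ts0] := eqVneq (size ts) 0%N.
rewrite -ussz; apply: IH; rewrite ?ussz//.
- rewrite /d /g /expsum_deriv /expsum_shift -map_comp sorted_map.
  by apply: sub_sorted rP => x y /=; rewrite lerD2r.
(* If the derivative vanished, [expsum g] would be a constant of both weak signs, hence zero, and so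
   would [expsum r]. *)
- apply: contrapT => d0.
  have gc x : expsum g x = expsum g 0.
    apply: expsum_deriv_eq0 => y; apply/eqP; apply: contrapT => /negP h.
    by apply: d0; exists y.
  case: ts ts0 gA {sz tsP tsA ussz} => //= t' ts _.
  rewrite !(gc t) (gc t') mulNr oppr_ge0 => /and3P[h1 h2 _].
  have /eqP : s * expsum g 0 = 0 by apply/le_anti/andP.
  rewrite mulf_eq0 (negbTE s0)/= => /eqP g0; case: f0 => x.
  have := gc x; rewrite g0 expsum_shiftE => /eqP.
  by rewrite mulf_eq0 expR_eq0/= => /eqP->; rewrite eqxx.
- exact: path_sorted usP.
Qed.
End ExponentialSums.

(* At most [n./2.-1] dips in each of [n.-1] off-diagonal entries of a column; for
   even [n] at most one entry attains this, so the others have one fewer. *)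
Definition dip_bound (n : nat) : nat :=
  (if odd n then n.-1 * n./2.-1 else n./2.-1 * (n - 3))%N.

(** * Real powers of a matrix with positive spectrum *)

Section PositiveSpectrum.
Variables (R : realType) (n : nat) (A U : 'M[R]_n) (lambda : 'rV[R]_n).
Hypotheses (UTU : U^T *m U = 1%:M) (AE : A = U *m diag_mx lambda *m U^T).
Hypotheses (A_ge0 : nonnegmx A) (lambda_gt0 : forall k, 0 < lambda 0 k).

Let UUT : U *m U^T = 1%:M. Proof. exact: mulmx1C. Qed.

Lemma mul_diag_trmxE (D : 'rV[R]_n) i j :
  (U *m diag_mx D *m U^T) i j = \sum_k U i k * U j k * D 0 k.
Proof.
rewrite mxE; apply: eq_bigr => k _; rewrite mul_mx_diag !mxE; ring.
Qed.

(** The power [A^t], written with exponentials so that its entries are exponential sums in [t], also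
    at [t = 0]. *)
Definition contpow (t : R) : 'M[R]_n :=
  U *m diag_mx (\row_k expR (ln (lambda 0 k) * t)) *m U^T.

Lemma contpow0 : contpow 0 = 1%:M.
Proof.
rewrite /contpow (_ : \row_k _ = const_mx 1); last first.
  by apply/rowP => k; rewrite !mxE mulr0 expR0.
by rewrite diag_const_mx mulmx1.
Qed.

Lemma contpowD1 t : contpow (t + 1) = A *m contpow t.
Proof.
rewrite AE /contpow !mulmxA -(mulmxA _ U^T U) UTU mulmx1.
rewrite -(mulmxA U (diag_mx _) (diag_mx _)) mulmx_diag.
congr (U *m diag_mx _ *m _); apply/rowP => k; rewrite !mxE.
by rewrite mulrDr mulr1 expRD lnK ?posrE// mulrC.
Qed.

Lemma contpow_nat_ge0 (k : nat) : nonnegmx (contpow k%:R).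
Proof.
elim: k => [|k IH] i j; first by rewrite contpow0 mxE ler0n.
by rewrite -natr1 contpowD1 mxE sumr_ge0// => l _; rewrite mulr_ge0.
Qed.

Lemma contpow_diag_ge0 j t : 0 <= contpow t j j.
Proof.
rewrite mul_diag_trmxE sumr_ge0// => k _.
by rewrite mxE mulr_ge0 ?expR_ge0// -expr2 sqr_ge0.
Qed.

Lemma contpow_col_ge0 (k : nat) j :
  (forall i u, k%:R <= u <= k.+1%:R -> 0 <= contpow u i j) ->
  forall i t, k%:R <= t -> 0 <= contpow t i j.
Proof.
move=> good i t kt.
have [m tm] : exists m : nat, t <= k.+1%:R + m%:R.
  exists (Num.truncn t).+1; rewrite (le_trans (ltW (truncnS_gt t)))//.
  by rewrite lerDr ler0n.
elim: m i t kt tm => [|m IH] i t kt tm.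
  by rewrite good// kt/= -[k.+1%:R]addr0.
have [tk|/ltW tk] := leP t k.+1%:R; first by rewrite good// kt.
rewrite -(subrK 1 t) contpowD1 mxE sumr_ge0// => l _; rewrite mulr_ge0//.
apply: IH; move: tk tm; rewrite -(natr1 k) -(natr1 m); lra.
Qed.

Definition decreasing_spectrum : seq 'I_n :=
  sort (fun k l => lambda 0 l <= lambda 0 k) (enum 'I_n).

Lemma size_decreasing_spectrum : size decreasing_spectrum = n.
Proof. by rewrite size_sort size_enum_ord. Qed.

Lemma mem_decreasing_spectrum k : k \in decreasing_spectrum.
Proof. by rewrite mem_sort mem_enum. Qed.

Definition entry_spectrum i j : seq (R * R) :=
  [seq (U i k * U j k, ln (lambda 0 k)) | k <- decreasing_spectrum].

Lemma contpow_expsum i j t : contpow t i j = expsum (entry_spectrum i j) t.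
Proof.
rewrite mul_diag_trmxE /expsum big_map/=.
rewrite [RHS](perm_big (enum 'I_n)) ?perm_sort//= [RHS]big_enum/=.
by apply: eq_bigr => k _; rewrite mxE.
Qed.

Lemma sorted_entry_spectrum i j :
  sorted (fun p q => q.2 <= p.2) (entry_spectrum i j).
Proof.
rewrite sorted_map.
apply: (@sub_sorted _ (fun k l => lambda 0 l <= lambda 0 k)).
  by move=> k l /=; rewrite ler_ln ?posrE.
by apply: sort_sorted => k l; rewrite le_total.
Qed.

(** * Counting dips in a column *)

Definition dips i j (k : nat) : bool :=
  `[< exists2 u, k%:R < u < k.+1%:R & contpow u i j < 0 >].

(* The values at [k + 1] and at a negative point of the [k]-th dip, for
   decreasing [k], followed by those at [1] and [0], alternate in sign. *)
Lemma dips_weakly_alternating i j (m : nat) (L : seq nat) : i != j ->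
  (0 < m)%N -> path gtn m L -> all (fun k => 0 < k)%N L -> all (dips i j) L ->
  exists ts, [/\ sorted >%R ts, all (fun t => t <= m%:R) ts,
    size ts = (2 * size L + 2)%N
    & weakly_alternating 1 (expsum (entry_spectrum i j)) ts].
Proof.
move=> ij; elim: L m => [|k L IH] m m0.
  move=> _ _ _; exists [:: 1; 0]; split => //=.
  - by rewrite ltr01.
  - by rewrite ler1n m0 ler0n.
  (* The off-diagonal entry of [A^0 = I] is zero, which passes for the required nonpositive
     value. *)
  - rewrite -!contpow_expsum contpow0 [1%:M _ _]mxE (negbTE ij).
    rewrite mulr0 lexx !andbT mul1r.
    exact: (contpow_nat_ge0 1).
move=> /= /andP[km Lk] /andP[k0 L0] /andP[/asboolP[u /andP[ku uk] fu] Ld].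
have [ts [tsP tsk tssz tsA]] := IH k k0 Lk L0 Ld.
exists [:: k.+1%:R, u & ts]; split => /=.
- rewrite uk/=; case: ts tsP tsk {tssz tsA} => //= t ts -> /andP[tk _].
  by rewrite (le_lt_trans tk ku).
- have k1m : k.+1%:R <= m%:R :> R by rewrite ler_nat.
  rewrite k1m (le_trans (ltW uk))//=; apply: sub_all tsk => t tk.
  by rewrite (le_trans tk)// ler_nat ltnW.
- by rewrite tssz mulnS.
- rewrite -!contpow_expsum mul1r contpow_nat_ge0 opprK tsA andbT/=.
  by rewrite mulN1r oppr_ge0 ltW.
Qed.

(** Descartes' rule applied to the points found above; the presence of a dip shows that the sum is
    not identically zero. *)
Lemma dips_alternations i j (N : nat) : i != j ->
  (0 < count (dips i j) (iota 1 N))%N ->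
  (2 * count (dips i j) (iota 1 N) + 2 <=
    alternations 1%R [seq (U i k * U j k)%R | k <- decreasing_spectrum])%N.
Proof.
move=> ij b0; pose L := rev [seq k <- iota 1 N | dips i j k].
have Lsz : size L = count (dips i j) (iota 1 N) by rewrite size_rev size_filter.
have LP : path gtn N.+1 L.
  have -> : path gtn N.+1 L = sorted gtn (N.+1 :: L) by [].
  rewrite -rev_rcons rev_sorted -cats1 sorted_pairwise; last exact: ltn_trans.
  rewrite pairwise_cat -sorted_pairwise; last exact: ltn_trans.
  rewrite sorted_filter ?iota_ltn_sorted//=; last exact: ltn_trans.
  rewrite !andbT; apply/allrelP => x y; rewrite mem_filter mem_iota inE.
  by move=> /and3P[_ _ h] /eqP->; rewrite add1n in h.
have L0 : all (fun k => 0 < k)%N L.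
  by apply/allP => x; rewrite mem_rev mem_filter mem_iota => /and3P[].
have Ld : all (dips i j) L by rewrite all_rev filter_all.
have [ts [tsP _ tssz tsA]] := dips_weakly_alternating ij (ltn0Sn N) LP L0 Ld.
rewrite -Lsz -tssz.
have -> : [seq (U i k * U j k)%R | k <- decreasing_spectrum] =
          [seq p.1 | p <- entry_spectrum i j] by rewrite -map_comp.
apply: expsum_alternations tsA; rewrite ?oner_neq0 ?sorted_entry_spectrum//.
move: b0; rewrite -has_count => /hasP[k _ /asboolP[u _ fu]].
by exists u; rewrite -contpow_expsum lt_eqF.
Qed.

(* If two rows reach the maximal number of dips, then both coefficient sequences
   strictly alternate, hence all products [U i k * U i' k] are positive,
   although rows [i] and [i'] are orthogonal. *)
Lemma max_dips_unique i i' j (N : nat) : i != j -> i' != j ->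
  (0 < count (dips i j) (iota 1 N))%N -> (0 < count (dips i' j) (iota 1 N))%N ->
  (n <= 2 * count (dips i j) (iota 1 N) + 2)%N ->
  (n <= 2 * count (dips i' j) (iota 1 N) + 2)%N -> i = i'.
Proof.
move=> ij i'j b0 b'0 bn b'n; apply/eqP; apply: contraT => ii'.
have full l : l != j -> (0 < count (dips l j) (iota 1 N))%N ->
    (n <= 2 * count (dips l j) (iota 1 N) + 2)%N ->
    alternations 1 [seq U l k * U j k | k <- decreasing_spectrum]
    = size decreasing_spectrum.
  move=> lj /(dips_alternations lj) h1 h2; apply/eqP; rewrite eqn_leq.
  rewrite -[X in (_ <= X)%N](size_map (fun k => U l k * U j k)).
  by rewrite alternations_le_size size_decreasing_spectrum (leq_trans h2).
have pos k : 0 < U i k * U i' k.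
  have := alternations_full (full i ij b0 bn) (full i' i'j b'0 b'n)
    (mem_decreasing_spectrum k).
  apply: contraLR; rewrite -!leNgt => h.
  by rewrite mulrACA mulr_le0_ge0// -expr2 sqr_ge0.
have : (U *m U^T) i i' = 0 by rewrite UUT mxE (negbTE ii').
rewrite mxE => /eqP; rewrite psumr_eq0 => [/allP/(_ i)|k _]; last first.
  by rewrite mxE ltW.
by rewrite mem_index_enum mxE gt_eqF// => /(_ isT).
Qed.

Lemma sum_dips_le j (N : nat) :
  (\sum_(i | i != j) count (dips i j) (iota 1 N) <= dip_bound n)%N.
Proof.
pose b i := count (dips i j) (iota 1 N).
change (\sum_(i | i != j) b i <= dip_bound n)%N.
have b_le i : i != j -> (2 * b i + 2 <= n)%N.
  move=> ij; have [b0|b0] := posnP (b i).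
    (* Two distinct indices give [2 <= n]. *)
    by rewrite b0; have := max_card (pred2 i j); rewrite card2 ij card_ord.
  have /leq_trans := dips_alternations ij b0; apply.
  by rewrite (leq_trans (alternations_le_size _ _))// size_map
    size_decreasing_spectrum.
have card_neq : #|[pred i | i != j]| = n.-1.
  by rewrite cardC1 card_ord.
rewrite /dip_bound; case: ifPn => oddn.
  rewrite -card_neq -sum_nat_const leq_sum// => i /b_le; lia.
have [n_le|n_gt] := leqP n 3.
  rewrite big1// => i /b_le; lia.
(* As [n] is even, missing the maximum costs a whole dip. *)
have [[i0 i0j i0n]|no_max] :
    (exists2 i, i != j & n = (2 * b i + 2)%N) \/
    (forall i, i != j -> (2 * b i + 4 <= n)%N).
  case: (pselect (exists2 i, i != j & n = (2 * b i + 2)%N)); first by left.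
  move=> h; right => i ij; have := b_le i ij.
  have : n <> (2 * b i + 2)%N by move=> e; apply: h; exists i.
  lia.
- have rest i : (i != j) && (i != i0) -> (b i <= n./2 - 2)%N.
    move=> /andP[ij ii0]; have := b_le i ij.
    have : n <> (2 * b i + 2)%N; last lia.
    move=> e; move: ii0.
    by rewrite (@max_dips_unique i i0 j N) ?eqxx// -/(b _); lia.
  rewrite (bigD1 i0)//=.
  have := leq_sum (index_enum _) rest; rewrite sum_nat_const.
  have -> : #|[pred i | (i != j) && (i != i0)]| = n.-2.
    have := cardD1 i0 [pred i | i != j]; rewrite card_neq inE i0j add1n.
    move=> e; rewrite [in RHS]e/=; apply: eq_card => i; rewrite !inE andbC //.
  move=> h; apply: leq_trans (leq_add (leqnn _) h) _.
  (* With [h = n / 2], the total is [(h - 1) + (2h - 2)(h - 2) = (h - 1)(2h - 3)]. *)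
  have [h' h'E] : exists h', n = (2 * h' + 4)%N by exists (b i0).-1; lia.
  have -> : b i0 = h'.+1 by lia.
  have -> : n./2 = h'.+2 by lia.
  rewrite h'E; nia.
- apply: (@leq_trans (\sum_(i < n | i != j) (n./2 - 2))%N).
    by apply: leq_sum => i /no_max; lia.
  rewrite sum_nat_const card_neq.
  have [h' h'E] : exists h', n = (2 * h' + 4)%N by exists (n./2 - 2)%N; lia.
  have -> : n./2 = h'.+2 by lia.
  rewrite h'E; nia.
Qed.

(** Pigeonhole: the column has at most [dip_bound n] dips, spread over [dip_bound n + 1]
    intervals. *)
Lemma exists_dipless_column j :
  exists2 k : nat, (k <= (dip_bound n).+1)%N & forall i, i != j -> ~~ dips i j k.
Proof.
apply: contrapT => none.
have bad k : k \in iota 1 (dip_bound n).+1 ->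
    (1 <= \sum_(i | i != j) dips i j k)%N.
  rewrite mem_iota add1n ltnS => /andP[_ kN].
  rewrite lt0n sum_nat_eq0; apply/negP => /forallP h; apply: none.
  by exists k => // i ij; have := h i; rewrite ij/= eqb0.
have : (\sum_(k <- iota 1 (dip_bound n).+1) 1 <=
    \sum_(k <- iota 1 (dip_bound n).+1) \sum_(i | i != j) dips i j k)%N.
  by rewrite big_seq [leqRHS]big_seq; apply: leq_sum => k; exact: bad.
rewrite sum1_size size_iota exchange_big/=.
have -> : (\sum_(i | i != j) \sum_(k <- iota 1 (dip_bound n).+1) dips i j k =
    \sum_(i | i != j) count (dips i j) (iota 1 (dip_bound n).+1))%N.
  by apply: eq_bigr => i _; rewrite -sum1_count [RHS]big_mkcond.
by move=> /leq_trans/(_ (sum_dips_le j _)); rewrite ltnn.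
Qed.

Lemma contpow_ge0 t : (dip_bound n).+1%:R <= t -> nonnegmx (contpow t).
Proof.
move=> Nt i j; have [k kN good] := exists_dipless_column j.
apply: (@contpow_col_ge0 k); last by rewrite (le_trans _ Nt)// ler_nat.
move=> l u /andP[ku uk].
have [->|lj] := eqVneq l j; first exact: contpow_diag_ge0.
move: ku uk; case: ltgtP => // [ku _|<- _ _]; last exact: contpow_nat_ge0.
case: ltgtP => // [uk _|-> _]; last exact: contpow_nat_ge0.
rewrite leNgt; apply: contra (good l lj) => fu.
by apply/asboolP; exists u; rewrite // ku.
Qed.

End PositiveSpectrum.

(** * Closed form of the bound and passage to singular matrices *)

Lemma m_bound_dip_bound (R : realType) (n : nat) : (0 < n)%N ->
  m_bound R n = (dip_bound n).+1%:R.
Proof.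
move=> n0; rewrite /m_bound /dip_bound; case: ifPn => oddn.
- have [[|m] nE] : exists m, n = (2 * m).+1%N by exists n./2; lia.
    by rewrite nE/=; lra.
  have -> : n./2 = m.+1 by lia.
  by rewrite nE !(natrX, natrM, =^~ natr1)/=; field.
- have [[|[|m]] nE] : exists m, n = (2 * m)%N.
    by exists n./2; rewrite mul2n even_halfK.
  + by lia.
  + by rewrite nE/=; lra.
  have -> : n./2 = m.+2 by lia.
  have -> : (n - 3 = (2 * m).+1)%N by lia.
  by rewrite nE !(natrX, natrM, =^~ natr1)/=; field.
Qed.

(** At [l = 0] the limit is [0^t = 0], by [0 < t]; elsewhere the power is continuous. *)
Lemma powR_cvg_addr (R : realType) (l t : R) : 0 <= l -> 0 < t ->
  (powR (l + e) t @[e --> 0^'+] --> powR l t)%classic.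
Proof.
rewrite le_eqVlt => /predU1P[<-|l0] t0.
  rewrite powR0 ?gt_eqF//; under eq_fun do rewrite add0r.
  exact: powR_cvg0.
have powC : {for l, continuous (fun x : R => powR x t)}.
  apply: differentiable_continuous; apply/derivable1_diffP.
  by apply: derivable_powR; rewrite in_itv/= l0.
have addC : (l + e @[e --> 0^'+] --> l)%classic.
  rewrite -[X in (_ --> X)%classic]addr0.
  apply: cvg_at_right_filter.
  by apply: cvgD; [exact: cvg_cst|exact: cvg_id].
exact: (continuous_cvg _ powC addC).
Qed.

Lemma mxpow_of_ge0 (R : realType) (n : nat) (A U : 'M[R]_n) (lambda : 'rV[R]_n)
    t : (0 < n)%N -> nonnegmx A -> spectral_decomp A U lambda ->
  (forall k, 0 <= lambda 0 k) -> 0 < t -> m_bound R n <= t ->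
  nonnegmx (mxpow_of U lambda t).
Proof.
move=> n0 A0 [UTU AE] l0 t0 nt i j.
pose lambda_ (e : R) := lambda + const_mx e.
have pos e : 0 < e -> 0 <= mxpow_of U (lambda_ e) t i j.
  move=> e0.
  have le_gt0 k : 0 < lambda_ e 0 k by rewrite !mxE ltr_wpDl.
  have AeE : A + e%:M = U *m diag_mx (lambda_ e) *m U^T.
    rewrite linearD/= diag_const_mx mulmxDr mulmxDl -AE mul_mx_scalar.
    by rewrite -scalemxAl mulmx1C// scalemx1.
  have Ae_ge0 : nonnegmx (A + e%:M).
    by move=> p q; rewrite !mxE addr_ge0// mulrn_wge0// ltW.
  rewrite (_ : mxpow_of _ _ _ = contpow U (lambda_ e) t).
    by apply: (contpow_ge0 UTU AeE); rewrite // -m_bound_dip_bound.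
  congr (_ *m diag_mx _ *m _); apply/rowP => k.
  by rewrite !mxE /powR gt_eqF ?ltr_wpDl// [ln _ * t]mulrC.
have cvg : (mxpow_of U (lambda_ e) t i j @[e --> 0^'+] -->
    mxpow_of U lambda t i j)%classic.
  rewrite /mxpow_of mul_diag_trmxE; under eq_fun do rewrite mul_diag_trmxE.
  apply: cvg_big; first exact: add_continuous.
  move=> k _; apply: cvgMr; rewrite mxE; under eq_fun do rewrite !mxE.
  exact: powR_cvg_addr.
apply: cvgr_to_ge cvg _; near=> e; apply: pos.
by near: e; exact: nbhs_right_gt.
Unshelve. all: by end_near.
Qed.

(** * Positive semidefiniteness and conclusion *)

Lemma quad_mul_diag_trmx (R : realType) (n : nat) (U : 'M[R]_n) (D : 'rV[R]_n)
    (x : 'cV[R]_n) :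
  (x^T *m (U *m diag_mx D *m U^T) *m x) 0 0 =
  \sum_k D 0 k * ((U^T *m x) k 0) ^+ 2.
Proof.
rewrite !mulmxA -[_ *m x]mulmxA mxE; apply: eq_bigr => k _.
rewrite mul_mx_diag mxE -[x^T *m U]trmxK trmx_mul trmxK [_^T 0 k]mxE; ring.
Qed.

(** The quadratic form at the [k]-th eigenvector equals the [k]-th eigenvalue. *)
Lemma spectral_decomp_psd_ge0 (R : realType) (n : nat) (A U : 'M[R]_n)
    (lambda : 'rV[R]_n) : psdmx A -> spectral_decomp A U lambda ->
  forall k, 0 <= lambda 0 k.
Proof.
move=> [_ Apsd] [UTU AE] k; have := Apsd (U *m delta_mx k 0).
rewrite AE quad_mul_diag_trmx mulmxA UTU mul1mx (bigD1 k)//= big1.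
  by rewrite mxE !eqxx expr1n mulr1 addr0.
by move=> l /negbTE lk; rewrite mxE lk expr0n mulr0.
Qed.

(* m(n) <= bound  <=>  bound is an admissible exponent (the admissible set is upward closed
   and m(n) is its least element) *)
Theorem theorem3p1 (R : realType) (n : nat) (hn : (0 < n)%N) :
  admissible_exponent n (m_bound R n).
Proof.
move=> t t0 nt A [_ [Apsd A0]] U lambda dec.
have l0 := spectral_decomp_psd_ge0 Apsd dec.
have sym : Defs.symmetricmx (mxpow_of U lambda t).
  by rewrite /Defs.symmetricmx /mxpow_of !trmx_mul trmxK tr_diag_mx mulmxA.
split => //; split; last exact: mxpow_of_ge0 A0 dec l0 t0 nt.
split => // x; rewrite quad_mul_diag_trmx sumr_ge0// => k _.
by rewrite mxE mulr_ge0 ?powR_ge0 ?sqr_ge0.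
Qed.
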